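(* Let $(\mathscr{L},\vdash)$ be a logical structure. Then the following statements are equivalent. (1) $(\mathscr{L},\vdash)$ is of Tarski-type and of Lindenbaum-IV-type. (2) For all $\Gamma\cup\{\alpha\}\subseteq\mathscr{L}$ with $\Gamma\nvdash\alpha$, there exists a strongly closed $\Sigma\supseteq\Gamma$ which is relatively maximal in $\alpha$. (3) For all $\Gamma\cup\{\alpha\}\subseteq\mathscr{L}$ with $\Gamma\nvdash\alpha$, there exists a strongly closed $\alpha$-saturated $\Sigma\supseteq\Gamma$. (4) For all $\Gamma\cup\{\alpha\}\subseteq\mathscr{L}$ with $\Gamma\nvdash\alpha$, there exist $\beta\in\mathscr{L}$ and a strongly closed $\beta$-saturated $\Sigma\supseteq\Gamma$ such that $\Sigma\nvdash\alpha$ and $\{\beta\}\vdash\alpha$. (5) For each $\alpha\in\mathscr{L}$ there exists $\beta\in\mathscr{L}$ such that for every $\Gamma\subseteq\mathscr{L}$, if $\Gamma\nvdash\alpha$ then there exists a strongly closed $\beta$-saturated $\Sigma\supseteq\Gamma$ with $\Sigma\nvdash\alpha$.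
   Context: A logical structure is a pair $(\mathscr{L},\vdash)$ with $\mathscr{L}$ a nonempty set and $\vdash\subseteq\mathcal{P}(\mathscr{L})\times\mathscr{L}$ nonempty; write $\Gamma\vdash\alpha$ for $(\Gamma,\alpha)\in\vdash$. It is of Tarski-type if it is reflexive ($\alpha\in\Gamma\Rightarrow\Gamma\vdash\alpha$), monotone ($\Gamma\vdash\alpha$, $\Gamma\subseteq\Sigma\Rightarrow\Sigma\vdash\alpha$) and transitive (if $\Gamma\vdash\beta$ for all $\beta\in\Sigma$ and $\Sigma\vdash\alpha$ then $\Gamma\vdash\alpha$). $\Gamma$ is strongly closed if $\Gamma\vdash\alpha$ for all $\alpha\in\Gamma$ and, for every $\alpha$, if some $\Gamma'\subseteq\Gamma$ has $\Gamma'\vdash\alpha$ then $\alpha\in\Gamma$. $\Gamma$ is $\alpha$-saturated if $\Gamma\nvdash\alpha$ but $\Gamma\cup\{\beta\}\vdash\alpha$ for all $\beta\in\mathscr{L}\setminus\Gamma$. $\Gamma$ is relatively maximal in $\alpha$ if $\Gamma\nvdash\alpha$ but $\Sigma\vdash\alpha$ for every $\Sigma\supsetneq\Gamma$. $(\mathscr{L},\vdash)$ is of Lindenbaum-IV-type if for all $\Gamma\cup\{\alpha\}$ with $\Gamma\nvdash\alpha$ there is $\Sigma\supseteq\Gamma$ relatively maximal in $\alpha$. *)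

(* Defs.v *)
From mathcomp Require Import all_boot.
From mathcomp Require Import boolp classical_sets.

Set Implicit Arguments.
Unset Strict Implicit.
Unset Printing Implicit Defensive.

Local Open Scope classical_set_scope.

Record logicalStructure := LogicalStructure {
  carrier :> Type;
  entails : set carrier -> carrier -> Prop;
  carrier_nonempty : [set: carrier] !=set0;
  entails_nonempty : exists (G : set carrier) (a : carrier), entails G a }.

Notation "G ⊢ a" := (entails G a) (at level 70, no associativity).
Notation "G ⊬ a" := (~ entails G a) (at level 70, no associativity).

Section LogicalStructureTheory.
Variable L : logicalStructure.
Implicit Types (G S : set L) (a b : L).

Definition is_reflexive : Prop := forall G a, G a -> G ⊢ a.

Definition is_monotone : Prop :=
  forall G S a, G ⊢ a -> G `<=` S -> S ⊢ a.

Definition is_transitive : Prop :=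
  forall G S a, (forall b, S b -> G ⊢ b) -> S ⊢ a -> G ⊢ a.

Definition tarski_type : Prop :=
  [/\ is_reflexive, is_monotone & is_transitive].

Definition strongly_closed G : Prop :=
  (forall a, G a -> G ⊢ a) /\
  (forall a, (exists2 G', G' `<=` G & G' ⊢ a) -> G a).

Definition saturated a G : Prop :=
  G ⊬ a /\ forall b, ~ G b -> G `|` [set b] ⊢ a.

Definition relatively_maximal a G : Prop :=
  G ⊬ a /\ forall S, G `<` S -> S ⊢ a.

Definition lindenbaum_IV_type : Prop :=
  forall G a, G ⊬ a -> exists2 S, G `<=` S & relatively_maximal a S.

End LogicalStructureTheory.

Arguments is_reflexive : clear implicits.
Arguments is_monotone : clear implicits.
Arguments is_transitive : clear implicits.
Arguments tarski_type : clear implicits.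
Arguments lindenbaum_IV_type : clear implicits.

(* Main.v *)
Require Import Defs.
From mathcomp Require Import all_boot.
From mathcomp Require Import boolp classical_sets.

Local Open Scope classical_set_scope.

(** Each of (2)-(5) separates a non-consequence [a] of [G] from [G] by a
    strongly closed superset, which already forces the structure to be of
    Tarski-type. Over a Tarski-type structure, relatively maximal and saturated
    sets coincide and are strongly closed. In (5), since [b] does not depend on
    [G], a [b]-saturated [S] with [S ⊬ a] is also [a]-saturated: if
    [S `|` [set c] ⊬ a] with [c] outside [S], then (5) applied to
    [S `|` [set c]] yields a superset of it that does not entail [b]. *)

Lemma strongly_closed_entailsE (L : logicalStructure) (S : set L) (a : L) :
  strongly_closed S -> S ⊢ a <-> S a.
Proof.
by case=> Sent Scl; split=> [Sa|/Sent //]; apply: Scl; exists S.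
Qed.

(** If a Tarski axiom failed, a strongly closed [T] would contain the premises but not entail [a].
    Yet [T] absorbs whatever its subsets entail, so [a] lies in [T], and [T] entails its members.
    For transitivity [T] first absorbs [S], then [a]. *)
Lemma strongly_closed_separation_tarski (L : logicalStructure) :
  (forall (G : set L) (a : L), G ⊬ a ->
     exists S : set L, [/\ G `<=` S, strongly_closed S & S ⊬ a]) ->
  tarski_type L.
Proof.
move=> sep; split=> [G a Ga|G S a Ga GS|G S a GS Sa]; apply: contrapT.
- by move=> /sep[T [GT Tcl]]; apply; apply/strongly_closed_entailsE/GT.
- move=> /sep[T [ST Tcl]]; apply; apply/(strongly_closed_entailsE _ _ _ Tcl).
  by apply: Tcl.2; exists G => // b /GS/ST.
- move=> /sep[T [GT Tcl]]; apply; apply/(strongly_closed_entailsE _ _ _ Tcl).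
  by apply: Tcl.2; exists S => // b /GS Gb; apply: Tcl.2; exists G.
Qed.

Lemma relatively_maximal_saturated (L : logicalStructure) (S : set L) (a : L) :
  relatively_maximal a S -> saturated a S.
Proof.
move=> [Sa Smax]; split=> // b Sb; apply: Smax.
split; first exact: subsetUl.
by move=> sub; apply/Sb/sub; right.
Qed.

(** Any proper superset of [S] includes some one-point extension of [S], so monotonicity
    suffices. *)
Lemma saturated_relatively_maximal (L : logicalStructure) (S : set L) (a : L) :
  is_monotone L -> saturated a S -> relatively_maximal a S.
Proof.
move=> mono [Sa Ssat]; split=> // T [ST nTS].
have [c Tc Sc] : exists2 c, T c & ~ S c.
  apply: contrapT => nex; apply: nTS => c Tc.
  by apply: contrapT => Sc; apply: nex; exists c.
by apply: mono (Ssat _ Sc) _ => x [/ST //|->].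
Qed.

(** If a consequence [b] of a subset of [S] lay outside [S], cutting [b] from the entailment of [a]
    by [S] with [b] added would give [S ⊢ a]. *)
Lemma saturated_strongly_closed (L : logicalStructure) (S : set L) (a : L) :
  tarski_type L -> saturated a S -> strongly_closed S.
Proof.
move=> [refl mono trans] [Sa Ssat]; split=> [b /refl //|b [G GS Gb]].
apply: contrapT => /Ssat; apply: contra_not Sa => Sba.
by apply: trans Sba => c [/refl //|->]; apply: mono Gb GS.
Qed.

Lemma saturated_weaken (L : logicalStructure) (S : set L) (a b : L) :
  is_transitive L -> [set b] ⊢ a -> S ⊬ a -> saturated b S -> saturated a S.
Proof.
move=> trans ba Sa [_ Ssat]; split=> // c /Ssat Scb.
by apply: trans ba => _ ->.
Qed.

Theorem mainTheorem3 (L : logicalStructure) :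
  [<-> tarski_type L /\ lindenbaum_IV_type L;
       forall (G : set L) (a : L), G ⊬ a ->
         exists S : set L,
           [/\ G `<=` S, strongly_closed S & relatively_maximal a S];
       forall (G : set L) (a : L), G ⊬ a ->
         exists S : set L,
           [/\ G `<=` S, strongly_closed S & saturated a S];
       forall (G : set L) (a : L), G ⊬ a ->
         exists (b : L) (S : set L),
           [/\ G `<=` S, strongly_closed S, saturated b S, S ⊬ a
             & [set b] ⊢ a];
       forall a : L, exists b : L, forall G : set L, G ⊬ a ->
         exists S : set L,
           [/\ G `<=` S, strongly_closed S, saturated b S & S ⊬ a]].
Proof.
tfae.
- move=> [tarski lind] G a /lind[S GS Smax]; exists S; split=> //.
  exact/(saturated_strongly_closed _ _ a)/relatively_maximal_saturated.
- move=> sep G a /sep[S [GS Scl Smax]]; exists S; split=> //.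
  exact: relatively_maximal_saturated.
- move=> sep; have [refl _ _] : tarski_type L.
    apply: strongly_closed_separation_tarski => G a /sep[S [GS Scl [Sa _]]].
    by exists S.
  move=> G a /sep[S [GS Scl Ssat]]; exists a, S; split=> //.
    exact: Ssat.1.
  exact: refl.
- move=> sep; have [_ _ trans] : tarski_type L.
    apply: strongly_closed_separation_tarski => G a /sep[b [S [GS Scl _ Sa _]]].
    by exists S.
  (* The [b] supplied by (4) may vary with [G], so [a] itself is the uniform witness; [[set b] ⊢ a]
     carries saturation from [b] over to [a]. *)
  move=> a; exists a => G /sep[b [S [GS Scl Ssat Sa ba]]]; exists S; split=> //.
  exact: saturated_weaken Ssat.
- move=> sep; have tarski : tarski_type L.
    apply: strongly_closed_separation_tarski => G a.
    by have [b sepb] := sep a => /sepb[S [GS Scl _ Sa]]; exists S.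
  have [_ mono _] := tarski; split=> // G a.
  have [b sepb] := sep a => /sepb[S [GS _ [_ Ssat] Sa]]; exists S => //.
  apply: saturated_relatively_maximal => //; split=> // c Sc.
  apply: contrapT => /sepb[T [ScT _ [Tb _] _]].
  exact/Tb/(mono _ _ _ (Ssat _ Sc)).
Qed.
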